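(* Let $\mu>0$, $\rho_\pm>0$ and $u_\pm\in\mathbb{R}$ be fixed with $u_-<u_+$. For $k_1,k_2>0$ such that $(\rho_+,u_+)\in I(\rho_-,u_-)$, consider the two-rarefaction-wave ($R_1+R_2$) Riemann solution, with intermediate state $(\rho_*,u_* )$, of $$\begin{cases}\rho_t+(\rho u)_x=0,\\ (\rho u)_t+\left(-\dfrac{k_1}{\rho}+\rho u^2+\dfrac{k_2^2\rho^2}{2\mu}\right)_x=0,\end{cases}\qquad (\rho,u)(x,0)=(\rho_\pm,u_\pm)\ \text{ for }\ \pm x>0 .$$ Then, as $k_1,k_2\to0$, a vacuum state occurs, i.e. $\rho_*\to0$, and the two rarefaction waves $R_1$ and $R_2$ become two contact discontinuities $\xi=x/t=u_-$ and $\xi=x/t=u_+$, respectively, i.e. the characteristic speed $\lambda_1$ on $R_1$ tends to $u_-$ and the characteristic speed $\lambda_2$ on $R_2$ tends to $u_+$; these contact discontinuities connect the constant states $(\rho_-,u_-)$ and $(\rho_+,u_+)$, respectively, with the vacuum $(\rho=0)$.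
   Context: Put $w(\rho)=\sqrt{k_1/\rho^2+k_2^2\rho/\mu}$, $\lambda_1=u-w(\rho)$, $\lambda_2=u+w(\rho)$ (the eigenvalues of the system). The region $I(\rho_-,u_-)$ (depending on $k_1,k_2$) is the set of $(\rho,u)$ with $\rho>0$ lying on the large-$u$ side of the rarefaction curves $R_1$ and $R_2$ through $(\rho_-,u_-)$, i.e. $u>u_-+\left|\int_{\rho_-}^{\rho}\frac{w(s)}{s}\,ds\right|$. For $(\rho_+,u_+)\in I(\rho_-,u_-)$ the Riemann solution is a function of $\xi=x/t$ consisting of the constant state $(\rho_-,u_-)$, a rarefaction wave $R_1$, a constant intermediate state $(\rho_*,u_* )$ with $0<\rho_*\le\min(\rho_-,\rho_+)$, a rarefaction wave $R_2$, and the constant state $(\rho_+,u_+)$, where $$R_1:\ \xi=\lambda_1=u-w(\rho),\quad u=u_--\int_{\rho_-}^{\rho}\frac{w(s)}{s}\,ds,\quad \rho_*\le\rho\le\rho_-,$$ $$R_2:\ \xi=\lambda_2=u+w(\rho),\quad u=u_++\int_{\rho_+}^{\rho}\frac{w(s)}{s}\,ds,\quad \rho_*\le\rho\le\rho_+ ,$$ so that $\rho_*$ is determined by $u_+-u_-=\int_{\rho_*}^{\rho_-}\frac{w(s)}{s}ds+\int_{\rho_*}^{\rho_+}\frac{w(s)}{s}ds$. The limit $k_1,k_2\to0$ is the limit $(k_1,k_2)\to(0,0)$ through positive values, with $\mu,\rho_\pm,u_\pm$ fixed. A contact discontinuity here is a discontinuity of the limit along a ray $x/t=\text{const}$. *)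

(* Defs.v *)
From Stdlib Require Import Reals List.
From Coquelicot Require Import Coquelicot.
Open Scope R_scope.

(** ** The system and its characteristic speeds *)

Definition pressure (k1 k2 mu r : R) : R := - k1 / r + k2 ^ 2 * r ^ 2 / (2 * mu).

Definition w (k1 k2 mu r : R) : R := sqrt (k1 / r ^ 2 + k2 ^ 2 * r / mu).

Definition lambda1 (k1 k2 mu r v : R) : R := v - w k1 k2 mu r.
Definition lambda2 (k1 k2 mu r v : R) : R := v + w k1 k2 mu r.

(** [q_t + f_x = 0] at the point [(x, t)], in the classical sense. *)
Definition conservation_law_at (q f : R -> R -> R) (x t : R) : Prop :=
  exists dq df : R,
    is_derive (fun t' => q x t') t dq /\
    is_derive (fun x' => f x' t) x df /\
    dq + df = 0.

(** [rho] and [u] are profiles in [xi = x / t].  A solution containing only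
    rarefaction waves has no shocks: it is continuous, and it satisfies the
    equations classically off finitely many rays [x / t = const] (the edges of
    the waves).  For such functions this is the same as being a weak solution.
    The initial data are attained as [t] decreases to [0]. *)
Record continuous_riemann_solution
    (k1 k2 mu rm um rp up : R) (rho u : R -> R) : Prop := {
  crs_positive : forall xi, 0 < rho xi;
  crs_continuous : forall xi, continuous rho xi /\ continuous u xi;
  crs_equations : exists rays : list R, forall x t : R,
    0 < t -> ~ In (x / t) rays ->
    conservation_law_at
      (fun x t => rho (x / t))
      (fun x t => rho (x / t) * u (x / t)) x t /\
    conservation_law_at
      (fun x t => rho (x / t) * u (x / t))
      (fun x t => rho (x / t) * u (x / t) ^ 2
                  + pressure k1 k2 mu (rho (x / t))) x t;
  crs_initial_left : forall x, x < 0 ->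
    filterlim (fun t => rho (x / t)) (at_right 0) (locally rm) /\
    filterlim (fun t => u (x / t)) (at_right 0) (locally um);
  crs_initial_right : forall x, 0 < x ->
    filterlim (fun t => rho (x / t)) (at_right 0) (locally rp) /\
    filterlim (fun t => u (x / t)) (at_right 0) (locally up)
}.

(** ** Rarefaction curves and the two-rarefaction solution *)

Definition R1_velocity (k1 k2 mu rm um r : R) : R :=
  um - RInt (fun s => w k1 k2 mu s / s) rm r.

Definition R2_velocity (k1 k2 mu rp up r : R) : R :=
  up + RInt (fun s => w k1 k2 mu s / s) rp r.

Definition region_I (k1 k2 mu rm um r v : R) : Prop :=
  0 < r /\ v > um + Rabs (RInt (fun s => w k1 k2 mu s / s) rm r).

(** The wave pattern, from left to right in [xi].  The speed [lambda1] is
    decreasing in the density along [R1] and [lambda2] is increasing along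
    [R2], so that the condition [xi = lambda_i] determines the density inside
    each wave, and adjacent clauses agree on the common edge. *)
Record two_rarefaction_solution
    (k1 k2 mu rm um rp up rs us : R) (rho u : R -> R) : Prop := {
  trs_solution : continuous_riemann_solution k1 k2 mu rm um rp up rho u;
  trs_density : 0 < rs <= Rmin rm rp;
  trs_on_R1 : us = R1_velocity k1 k2 mu rm um rs;
  trs_on_R2 : us = R2_velocity k1 k2 mu rp up rs;
  trs_left : forall xi, xi <= lambda1 k1 k2 mu rm um ->
    rho xi = rm /\ u xi = um;
  trs_R1 : forall xi,
    lambda1 k1 k2 mu rm um <= xi <= lambda1 k1 k2 mu rs us ->
    rs <= rho xi <= rm /\
    u xi = R1_velocity k1 k2 mu rm um (rho xi) /\
    xi = lambda1 k1 k2 mu (rho xi) (u xi);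
  trs_middle : forall xi,
    lambda1 k1 k2 mu rs us <= xi <= lambda2 k1 k2 mu rs us ->
    rho xi = rs /\ u xi = us;
  trs_R2 : forall xi,
    lambda2 k1 k2 mu rs us <= xi <= lambda2 k1 k2 mu rp up ->
    rs <= rho xi <= rp /\
    u xi = R2_velocity k1 k2 mu rp up (rho xi) /\
    xi = lambda2 k1 k2 mu (rho xi) (u xi);
  trs_right : forall xi, lambda2 k1 k2 mu rp up <= xi ->
    rho xi = rp /\ u xi = up
}.

(** ** The limit *)

(** [(k1, k2) -> (0, 0)] through positive values. *)
Definition k_to_0 : (R * R -> Prop) -> Prop :=
  within (fun k : R * R => 0 < fst k /\ 0 < snd k) (locally ((0, 0) : R * R)).

(** Discontinuity of a profile along the ray [x / t = s], with left and right
    values [l] and [r]. *)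
Definition jump_at (f : R -> R) (s l r : R) : Prop :=
  filterlim f (at_left s) (locally l) /\
  filterlim f (at_right s) (locally r) /\
  l <> r.

(* Main.v *)
(** Since [sqrt k1 / s <= w s <= sqrt k1 / s + k2 * sqrt (s / mu)], the integral
    of [w s / s] over [[a, b]] equals [sqrt k1 * (1 / a - 1 / b)] up to [O(k2)].
    Hence [rs] bounded below would force the two integrals, whose sum is
    [up - um], to vanish in the limit.  On a wave, [w r] does not tend to [0]
    (it is of order [sqrt k1 / rs]), but it cancels the singular part
    [sqrt k1 / r] of the integral, leaving an error [O(sqrt k1 + k2)] that is
    uniform in [r]. *)

Require Import Defs.
From Stdlib Require Import Reals List Lra.
From Coquelicot Require Import Coquelicot.
Open Scope R_scope.

(** * Explicit bounds for [w] and for the integral of [w s / s] *)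

Lemma w_bounds (k1 k2 mu r : R) :
  0 < k1 -> 0 < k2 -> 0 < mu -> 0 < r ->
  sqrt k1 / r <= w k1 k2 mu r <= sqrt k1 / r + k2 * sqrt (r / mu).
Proof.
  intros h1 h2 hmu hr; unfold w.
  assert (hq : 0 < r / mu) by now apply Rdiv_lt_0_compat.
  assert (hA : 0 <= sqrt k1 / r).
  { apply Rmult_le_pos; [apply sqrt_pos | left; now apply Rinv_0_lt_compat]. }
  assert (hB : 0 <= k2 * sqrt (r / mu)).
  { apply Rmult_le_pos; [lra | apply sqrt_pos]. }
  (* The radicand is a sum of two squares of nonnegative numbers, so its root lies between the first
     number and their sum. *)
  assert (hE : k1 / r ^ 2 + k2 ^ 2 * r / mu
               = (sqrt k1 / r) ^ 2 + (k2 * sqrt (r / mu)) ^ 2).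
  { rewrite Rpow_mult_distr, pow2_sqrt by lra.
    unfold Rdiv at 3; rewrite Rpow_mult_distr, pow2_sqrt by lra.
    field; lra. }
  rewrite hE; split.
  - rewrite <- (sqrt_pow2 (sqrt k1 / r)) at 1 by assumption.
    apply sqrt_le_1_alt; nra.
  - rewrite <- (sqrt_pow2 (sqrt k1 / r + k2 * sqrt (r / mu))) by lra.
    apply sqrt_le_1_alt; nra.
Qed.

Lemma ex_RInt_w (k1 k2 mu a b : R) :
  0 < k1 -> 0 < k2 -> 0 < mu -> 0 < a -> 0 < b ->
  ex_RInt (fun s => w k1 k2 mu s / s) a b.
Proof.
  intros h1 h2 hmu ha hb.
  apply (ex_RInt_continuous (V := R_CompleteNormedModule)); intros s [hs _].
  assert (hs0 : 0 < s) by (apply Rlt_le_trans with (2 := hs); now apply Rmin_glb_lt).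
  apply (ex_derive_continuous (K := R_AbsRing) (V := R_NormedModule)).
  assert (0 < k1 / s ^ 2 + k2 ^ 2 * s / mu).
  { apply Rplus_lt_0_compat; apply Rdiv_lt_0_compat; try assumption.
    - now apply pow_lt.
    - apply Rmult_lt_0_compat; [now apply pow_lt | assumption]. }
  unfold w; auto_derive; repeat split; try lra.
  - apply Rgt_not_eq; nra.
  - simpl in *; lra.
Qed.

(** Divided by [s], both bounds of [w] have explicit primitives, built from [- sqrt k1 / s] and
    [2 * k2 * sqrt (s / mu)]. Dropping the value of the latter at [a] leaves an error that does not
    depend on [a]. *)
Lemma RInt_w_bounds (k1 k2 mu a b : R) :
  0 < k1 -> 0 < k2 -> 0 < mu -> 0 < a <= b ->
  sqrt k1 * (1 / a - 1 / b) <= RInt (fun s => w k1 k2 mu s / s) a b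
  <= sqrt k1 * (1 / a - 1 / b) + 2 * k2 * sqrt (b / mu).
Proof.
  intros h1 h2 hmu [ha hab].
  assert (hex : ex_RInt (fun s => w k1 k2 mu s / s) a b).
  { apply ex_RInt_w; lra. }
  assert (hlow : is_RInt (fun s => sqrt k1 / s / s) a b
                   (minus (- sqrt k1 / b) (- sqrt k1 / a))).
  { apply (is_RInt_derive (fun s => - sqrt k1 / s));
      rewrite Rmin_left, Rmax_right by assumption; intros s hs.
    - auto_derive; [lra | field; lra].
    - apply (ex_derive_continuous (K := R_AbsRing) (V := R_NormedModule)).
      auto_derive; lra. }
  assert (hup : is_RInt
     (fun s => (sqrt k1 / s + k2 * sqrt (s / mu)) / s) a b
     (minus (- sqrt k1 / b + 2 * k2 * sqrt (b / mu))
            (- sqrt k1 / a + 2 * k2 * sqrt (a / mu)))).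
  { apply (is_RInt_derive (fun s => - sqrt k1 / s + 2 * k2 * sqrt (s / mu)));
      rewrite Rmin_left, Rmax_right by assumption; intros s hs;
      assert (hq : 0 < s / mu) by (apply Rdiv_lt_0_compat; lra).
    - auto_derive; [repeat split; [lra | exact hq] |].
      assert (hsq := sqrt_lt_R0 _ hq).
      (* In terms of [t = sqrt (s / mu)] the derivative identity becomes rational, within reach of
         [field]. *)
      assert (he : s = mu * (sqrt (s / mu)) ^ 2).
      { rewrite pow2_sqrt by lra; field; lra. }
      unfold Rdiv in *.
      set (t := sqrt (s * / mu)) in *; rewrite he; field; lra.
    - apply (ex_derive_continuous (K := R_AbsRing) (V := R_NormedModule)).
      auto_derive; repeat split; lra || exact hq. }
  assert (hsa := sqrt_pos (a / mu)).
  assert (hb : forall s, a < s < b ->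
     sqrt k1 / s / s <= w k1 k2 mu s / s <=
     (sqrt k1 / s + k2 * sqrt (s / mu)) / s).
  { intros s hs.
    assert (hi : 0 <= / s) by (left; apply Rinv_0_lt_compat; lra).
    destruct (w_bounds k1 k2 mu s) as [hl hu]; try lra.
    split; apply Rmult_le_compat_r; assumption. }
  split.
  - replace (sqrt k1 * (1 / a - 1 / b)) with (RInt (fun s => sqrt k1 / s / s) a b).
    + apply RInt_le; [assumption | now eexists; exact hlow | assumption |].
      intros s hs; now apply hb.
    + rewrite (is_RInt_unique _ _ _ _ hlow).
      unfold minus, plus, opp; simpl; field; lra.
  - apply Rle_trans with
      (RInt (fun s => (sqrt k1 / s + k2 * sqrt (s / mu)) / s) a b).
    + apply RInt_le; [assumption | assumption | now eexists; exact hup |].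
      intros s hs; now apply hb.
    + rewrite (is_RInt_unique _ _ _ _ hup).
      unfold minus, plus, opp; simpl.
      assert (0 <= k2 * sqrt (a / mu)) by (apply Rmult_le_pos; lra).
      apply Rminus_le.
      match goal with |- ?x <= 0 =>
        replace x with (- (2 * (k2 * sqrt (a / mu)))) by (field; lra) end.
      lra.
Qed.

(** The term [1 / b] absorbs the part of order [sqrt k1] left at the outer density [b] of a wave,
    and [2 * sqrt (b / mu)] the part of order [k2]. Neither involves the density inside the wave. *)
Definition wave_error (mu b : R) : R := 1 / b + 2 * sqrt (b / mu).

Lemma wave_error_pos (mu b : R) : 0 < b -> 0 < wave_error mu b.
Proof.
  intros hb; unfold wave_error.
  assert (0 < 1 / b) by (apply Rdiv_lt_0_compat; lra).
  assert (h := sqrt_pos (b / mu)); lra.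
Qed.

(** The terms [sqrt k1 / r] cancel. What remains is [- sqrt k1 / b] and multiples of [k2], made
    uniform in [r] by [sqrt (r / mu) <= sqrt (b / mu)]. *)
Lemma RInt_w_sub_w_bound (k1 k2 mu r b : R) :
  0 < k1 -> 0 < k2 -> 0 < mu -> 0 < r <= b ->
  Rabs (RInt (fun s => w k1 k2 mu s / s) r b - w k1 k2 mu r)
  <= (sqrt k1 + k2) * wave_error mu b.
Proof.
  intros h1 h2 hmu hr.
  destruct (RInt_w_bounds k1 k2 mu r b) as [hl hu]; try assumption.
  destruct (w_bounds k1 k2 mu r) as [hl' hu']; try lra.
  assert (hs : sqrt (r / mu) <= sqrt (b / mu)).
  { apply sqrt_le_1_alt, Rmult_le_compat_r; [left; now apply Rinv_0_lt_compat | lra]. }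
  assert (hk := sqrt_pos k1); assert (hsr := sqrt_pos (r / mu)).
  assert (hb : 0 < 1 / b) by (apply Rdiv_lt_0_compat; lra).
  unfold wave_error.
  replace (sqrt k1 / r) with (sqrt k1 * (1 / r)) in * by (field; lra).
  apply Rabs_le; split; nra.
Qed.

(** Away from the vacuum the singular part is controlled by [1 / d]; this is what rules out [rs]
    staying above a positive [d]. *)
Lemma RInt_w_le (k1 k2 mu d r b : R) :
  0 < k1 -> 0 < k2 -> 0 < mu -> 0 < d <= r -> r <= b ->
  RInt (fun s => w k1 k2 mu s / s) r b
  <= (sqrt k1 + k2) * (1 / d + wave_error mu b).
Proof.
  intros h1 h2 hmu hd hr.
  destruct (RInt_w_bounds k1 k2 mu r b) as [_ hu]; try lra.
  assert (hk := sqrt_pos k1); assert (hs := sqrt_pos (b / mu)).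
  assert (hb : 0 < 1 / b) by (apply Rdiv_lt_0_compat; lra).
  assert (hd' : 0 < 1 / d) by (apply Rdiv_lt_0_compat; lra).
  assert (hrd : 1 / r <= 1 / d).
  { unfold Rdiv; rewrite !Rmult_1_l; apply Rinv_le_contravar; lra. }
  unfold wave_error; nra.
Qed.

(** The constant is symmetric in [a] and [b], so that exchanging the endpoints reduces to
    [a <= b]. *)
Lemma Rabs_RInt_w_le (k1 k2 mu a b : R) :
  0 < k1 -> 0 < k2 -> 0 < mu -> 0 < a -> 0 < b ->
  Rabs (RInt (fun s => w k1 k2 mu s / s) a b)
  <= (sqrt k1 + k2) * (1 / a + 1 / b + wave_error mu a + wave_error mu b).
Proof.
  intros h1 h2 hmu.
  assert (hk := sqrt_pos k1).
  assert (key : forall x y, 0 < x -> x <= y ->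
    Rabs (RInt (fun s => w k1 k2 mu s / s) x y)
    <= (sqrt k1 + k2) * (1 / x + 1 / y + wave_error mu x + wave_error mu y)).
  { intros x y hx hxy.
    assert (hx' : 0 < 1 / x) by (apply Rdiv_lt_0_compat; lra).
    assert (hy' : 0 < 1 / y) by (apply Rdiv_lt_0_compat; lra).
    assert (hex := wave_error_pos mu x hx).
    assert (hinv : 1 / y <= 1 / x).
    { unfold Rdiv; rewrite !Rmult_1_l; apply Rinv_le_contravar; lra. }
    destruct (RInt_w_bounds k1 k2 mu x y) as [hl _]; try lra.
    assert (h := RInt_w_le k1 k2 mu x x y h1 h2 hmu (conj hx (Rle_refl x)) hxy).
    rewrite Rabs_pos_eq; nra. }
  intros ha hb; destruct (Rle_dec a b) as [hab | hab].
  - now apply key.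
  - rewrite <- opp_RInt_swap by (apply ex_RInt_w; assumption).
    unfold opp; simpl; rewrite Rabs_Ropp.
    replace (1 / a + 1 / b + wave_error mu a + wave_error mu b)
      with (1 / b + 1 / a + wave_error mu b + wave_error mu a) by ring.
    apply key; lra.
Qed.

(** * Small parameters and one-sided neighbourhoods *)

#[local] Instance k_to_0_filter : Filter k_to_0.
Proof. apply within_filter, locally_filter. Qed.

Lemma k_to_0_small (C eps : R) :
  0 < C -> 0 < eps ->
  k_to_0 (fun k => (0 < fst k /\ 0 < snd k) /\
                   (sqrt (fst k) + snd k) * C < eps).
Proof.
  intros hC heps.
  (* Requiring [k1 < d ^ 2] and [k2 < d] makes [sqrt k1 + k2] less than [2 * d], and
     [2 * d * C = eps]. *)
  set (d := eps / (2 * C)).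
  assert (hd : 0 < d) by (apply Rdiv_lt_0_compat; lra).
  assert (hdE : d * C = eps / 2) by (unfold d; field; lra).
  assert (hd2 : 0 < Rmin (d ^ 2) d) by (apply Rmin_pos; [now apply pow_lt | assumption]).
  exists (mkposreal _ hd2); intros [k1 k2] [hk1 hk2] [h1 h2].
  simpl in hk1, hk2, h1, h2 |- *.
  change (Rabs (k1 - 0) < Rmin (d * (d * 1)) d) in hk1.
  change (Rabs (k2 - 0) < Rmin (d * (d * 1)) d) in hk2.
  assert (hm1 := Rmin_l (d * (d * 1)) d); assert (hm2 := Rmin_r (d * (d * 1)) d).
  rewrite Rminus_0_r, Rabs_pos_eq in hk1, hk2 by lra.
  split; [now split |].
  assert (hs : sqrt k1 < d).
  { rewrite <- (sqrt_pow2 d) by lra; apply sqrt_lt_1_alt; simpl; lra. }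
  nra.
Qed.

Lemma filterlim_eventually_const {T : Type} (F : (T -> Prop) -> Prop)
  {FF : Filter F} (f : T -> R) (l : R) :
  F (fun x => f x = l) -> filterlim f F (locally l).
Proof.
  intros h; apply (filterlim_ext_loc (fun _ => l)).
  - revert h; apply filter_imp; auto.
  - apply filterlim_const.
Qed.

Lemma at_left_above (a s : R) : a < s -> at_left s (fun x => a < x < s).
Proof.
  intros h; assert (hp : 0 < s - a) by lra.
  exists (mkposreal _ hp); intros y hy hys.
  apply Rabs_lt_between in hy; unfold minus, plus, opp in hy; simpl in hy; lra.
Qed.

Lemma at_right_below (s b : R) : s < b -> at_right s (fun x => s < x < b).
Proof.
  intros h; assert (hp : 0 < b - s) by lra.
  exists (mkposreal _ hp); intros y hy hys.
  apply Rabs_lt_between in hy; unfold minus, plus, opp in hy; simpl in hy; lra.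
Qed.

(** * Characteristic speeds along the two waves *)

Lemma R1_speed_bound (k1 k2 mu rm um r : R) :
  0 < k1 -> 0 < k2 -> 0 < mu -> 0 < r <= rm ->
  Rabs (lambda1 k1 k2 mu r (R1_velocity k1 k2 mu rm um r) - um)
  <= (sqrt k1 + k2) * wave_error mu rm.
Proof.
  intros h1 h2 hmu hr.
  assert (h := RInt_w_sub_w_bound k1 k2 mu r rm h1 h2 hmu hr).
  unfold lambda1, R1_velocity.
  rewrite <- opp_RInt_swap by (apply ex_RInt_w; lra).
  unfold opp; simpl.
  match goal with |- Rabs ?x <= _ => replace x with
    (RInt (fun s => w k1 k2 mu s / s) r rm - w k1 k2 mu r) by ring end.
  exact h.
Qed.

Lemma R2_speed_bound (k1 k2 mu rp up r : R) :
  0 < k1 -> 0 < k2 -> 0 < mu -> 0 < r <= rp ->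
  Rabs (lambda2 k1 k2 mu r (R2_velocity k1 k2 mu rp up r) - up)
  <= (sqrt k1 + k2) * wave_error mu rp.
Proof.
  intros h1 h2 hmu hr.
  assert (h := RInt_w_sub_w_bound k1 k2 mu r rp h1 h2 hmu hr).
  unfold lambda2, R2_velocity.
  rewrite <- opp_RInt_swap by (apply ex_RInt_w; lra).
  unfold opp; simpl.
  (* On [R2] the deviation of the speed is the integral minus [w] with the opposite sign. *)
  rewrite <- Rabs_Ropp.
  match goal with |- Rabs ?x <= _ => replace x with
    (RInt (fun s => w k1 k2 mu s / s) r rp - w k1 k2 mu r) by ring end.
  exact h.
Qed.

Lemma R1_velocity_start (k1 k2 mu rm um : R) :
  R1_velocity k1 k2 mu rm um rm = um.
Proof. unfold R1_velocity; rewrite RInt_point; unfold zero; simpl; ring. Qed.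

Lemma R2_velocity_start (k1 k2 mu rp up : R) :
  R2_velocity k1 k2 mu rp up rp = up.
Proof. unfold R2_velocity; rewrite RInt_point; unfold zero; simpl; ring. Qed.

(** The integral from [rm] to [rp] tends to 0, hence drops below the fixed gap [up - um]. *)
Lemma k_to_0_region_I (mu rm rp um up : R) :
  0 < mu -> 0 < rm -> 0 < rp -> um < up ->
  k_to_0 (fun k => (0 < fst k /\ 0 < snd k) /\
                   region_I (fst k) (snd k) mu rm um rp up).
Proof.
  intros hmu hrm hrp hu.
  assert (hC : 0 < 1 / rm + 1 / rp + wave_error mu rm + wave_error mu rp).
  { assert (0 < 1 / rm) by (apply Rdiv_lt_0_compat; lra).
    assert (0 < 1 / rp) by (apply Rdiv_lt_0_compat; lra).
    assert (a1 := wave_error_pos mu rm hrm).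
    assert (a2 := wave_error_pos mu rp hrp); lra. }
  generalize (k_to_0_small _ (up - um) hC ltac:(lra)).
  apply filter_imp; intros k [[h1 h2] hk]; repeat split; try assumption.
  assert (h := Rabs_RInt_w_le (fst k) (snd k) mu rm rp h1 h2 hmu hrm hrp); lra.
Qed.

(** * Vacuum and contact discontinuities in the limit *)

Theorem theorem3 (mu rm rp um up : R)
  (hmu : 0 < mu) (hrm : 0 < rm) (hrp : 0 < rp) (hu : um < up)
  (rs us : R * R -> R) (rho u : R * R -> R -> R)
  (hsol : forall k1 k2 : R, 0 < k1 -> 0 < k2 ->
     region_I k1 k2 mu rm um rp up ->
     two_rarefaction_solution k1 k2 mu rm um rp up
       (rs (k1, k2)) (us (k1, k2)) (rho (k1, k2)) (u (k1, k2))) :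
  (* vacuum *)
  filterlim rs k_to_0 (locally 0) /\
  (* the speed on the whole of R1 tends to um *)
  (forall eps : R, 0 < eps ->
     k_to_0 (fun k => forall r : R, rs k <= r <= rm ->
       Rabs (lambda1 (fst k) (snd k) mu r
               (R1_velocity (fst k) (snd k) mu rm um r) - um) < eps)) /\
  (* the speed on the whole of R2 tends to up *)
  (forall eps : R, 0 < eps ->
     k_to_0 (fun k => forall r : R, rs k <= r <= rp ->
       Rabs (lambda2 (fst k) (snd k) mu r
               (R2_velocity (fst k) (snd k) mu rp up r) - up) < eps)) /\
  (* the limit profile; its velocity is meaningful only off the vacuum *)
  (exists rho0 u0 : R -> R,
     (forall xi : R, xi <> um -> xi <> up ->
        filterlim (fun k => rho k xi) k_to_0 (locally (rho0 xi)) /\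
        (rho0 xi <> 0 ->
         filterlim (fun k => u k xi) k_to_0 (locally (u0 xi)))) /\
     (forall xi : R, xi < um -> rho0 xi = rm /\ u0 xi = um) /\
     (forall xi : R, um < xi < up -> rho0 xi = 0) /\
     (forall xi : R, up < xi -> rho0 xi = rp /\ u0 xi = up) /\
     (* contact discontinuity between (rm, um) and the vacuum *)
     jump_at rho0 um rm 0 /\ filterlim u0 (at_left um) (locally um) /\
     (* contact discontinuity between the vacuum and (rp, up) *)
     jump_at rho0 up 0 rp /\ filterlim u0 (at_right up) (locally up)).
Proof.
  assert (hsol' : k_to_0 (fun k => (0 < fst k /\ 0 < snd k) /\
    two_rarefaction_solution (fst k) (snd k) mu rm um rp up
      (rs k) (us k) (rho k) (u k))).
  { generalize (k_to_0_region_I mu rm rp um up hmu hrm hrp hu).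
    apply filter_imp; intros [k1 k2] [[h1 h2] hk]; split; [now split |].
    now apply hsol. }
  assert (hrs : filterlim rs k_to_0 (locally 0)).
  { apply filterlim_locally; intros [eps heps]; simpl.
    (* [C] adds the constants of [RInt_w_le] for the two waves at [d = eps]. If [eps <= rs k],
       equating the two expressions of [us k] gives [up - um <= (sqrt k1 + k2) * C < up - um]. *)
    set (C := (1 / eps + wave_error mu rm) + (1 / eps + wave_error mu rp)).
    assert (hC : 0 < C).
    { assert (0 < 1 / eps) by (apply Rdiv_lt_0_compat; lra).
      assert (a1 := wave_error_pos mu rm hrm).
      assert (a2 := wave_error_pos mu rp hrp); unfold C; lra. }
    generalize (filter_and _ _ hsol' (k_to_0_small C (up - um) hC ltac:(lra))).
    apply filter_imp; intros k [[[h1 h2] S] [_ hk]].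
    destruct (trs_density _ _ _ _ _ _ _ _ _ _ _ S) as [hr0 hr].
    assert (hm := Rmin_l rm rp); assert (hp := Rmin_r rm rp).
    change (Rabs (rs k - 0) < eps); rewrite Rminus_0_r, Rabs_pos_eq by lra.
    apply Rnot_le_lt; intros hle.
    assert (i1 := RInt_w_le (fst k) (snd k) mu eps (rs k) rm h1 h2 hmu
                    (conj heps hle) ltac:(lra)).
    assert (i2 := RInt_w_le (fst k) (snd k) mu eps (rs k) rp h1 h2 hmu
                    (conj heps hle) ltac:(lra)).
    assert (e1 := trs_on_R1 _ _ _ _ _ _ _ _ _ _ _ S).
    assert (e2 := trs_on_R2 _ _ _ _ _ _ _ _ _ _ _ S).
    unfold R1_velocity in e1; unfold R2_velocity in e2.
    rewrite <- opp_RInt_swap in e1, e2 by (apply ex_RInt_w; lra).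
    unfold opp in e1, e2; simpl in e1, e2.
    unfold C in hk; lra. }
  assert (hl1 : forall eps : R, 0 < eps ->
     k_to_0 (fun k => forall r : R, rs k <= r <= rm ->
       Rabs (lambda1 (fst k) (snd k) mu r
               (R1_velocity (fst k) (snd k) mu rm um r) - um) < eps)).
  { intros eps heps.
    generalize (filter_and _ _ hsol'
                  (k_to_0_small _ eps (wave_error_pos mu rm hrm) heps)).
    apply filter_imp; intros k [[[h1 h2] S] [_ hk]] r hr.
    destruct (trs_density _ _ _ _ _ _ _ _ _ _ _ S) as [hr0 _].
    apply Rle_lt_trans with (2 := hk), R1_speed_bound; lra. }
  assert (hl2 : forall eps : R, 0 < eps ->
     k_to_0 (fun k => forall r : R, rs k <= r <= rp ->
       Rabs (lambda2 (fst k) (snd k) mu r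
               (R2_velocity (fst k) (snd k) mu rp up r) - up) < eps)).
  { intros eps heps.
    generalize (filter_and _ _ hsol'
                  (k_to_0_small _ eps (wave_error_pos mu rp hrp) heps)).
    apply filter_imp; intros k [[[h1 h2] S] [_ hk]] r hr.
    destruct (trs_density _ _ _ _ _ _ _ _ _ _ _ S) as [hr0 _].
    apply Rle_lt_trans with (2 := hk), R2_speed_bound; lra. }
  (* The outer edge of [R1] is its speed at [r = rm], which tends to [um] and so eventually exceeds
     [xi]. *)
  assert (hleft : forall xi, xi < um ->
    k_to_0 (fun k => rho k xi = rm /\ u k xi = um)).
  { intros xi hxi.
    generalize (filter_and _ _ hsol' (hl1 (um - xi) ltac:(lra))).
    apply filter_imp; intros k [[_ S] hk].
    destruct (trs_density _ _ _ _ _ _ _ _ _ _ _ S) as [_ hr].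
    apply (trs_left _ _ _ _ _ _ _ _ _ _ _ S).
    assert (hm := Rmin_l rm rp).
    specialize (hk rm ltac:(lra)); rewrite R1_velocity_start in hk.
    apply Rabs_lt_between in hk; lra. }
  assert (hright : forall xi, up < xi ->
    k_to_0 (fun k => rho k xi = rp /\ u k xi = up)).
  { intros xi hxi.
    generalize (filter_and _ _ hsol' (hl2 (xi - up) ltac:(lra))).
    apply filter_imp; intros k [[_ S] hk].
    destruct (trs_density _ _ _ _ _ _ _ _ _ _ _ S) as [_ hr].
    apply (trs_right _ _ _ _ _ _ _ _ _ _ _ S).
    assert (hm := Rmin_r rm rp).
    specialize (hk rp ltac:(lra)); rewrite R2_velocity_start in hk.
    apply Rabs_lt_between in hk; lra. }
  (* The inner edges are the speeds at [r = rs k]; they tend to [um] and [up], so [xi] eventually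
     falls in the intermediate state. *)
  assert (hmid : forall xi, um < xi < up -> k_to_0 (fun k => rs k = rho k xi)).
  { intros xi hxi.
    generalize (filter_and _ _ hsol'
      (filter_and (F := k_to_0) _ _ (hl1 (xi - um) ltac:(lra))
         (hl2 (up - xi) ltac:(lra)))).
    apply filter_imp; intros k [[_ S] [hk1 hk2]].
    destruct (trs_density _ _ _ _ _ _ _ _ _ _ _ S) as [_ hr].
    assert (hm := Rmin_l rm rp); assert (hp := Rmin_r rm rp).
    specialize (hk1 (rs k) ltac:(lra)); specialize (hk2 (rs k) ltac:(lra)).
    rewrite <- (trs_on_R1 _ _ _ _ _ _ _ _ _ _ _ S) in hk1.
    rewrite <- (trs_on_R2 _ _ _ _ _ _ _ _ _ _ _ S) in hk2.
    apply Rabs_lt_between in hk1; apply Rabs_lt_between in hk2.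
    symmetry; apply (trs_middle _ _ _ _ _ _ _ _ _ _ _ S); lra. }
  split; [exact hrs | split; [exact hl1 | split; [exact hl2 |]]].
  set (rho0 := fun xi => if Rlt_dec xi um then rm else
                         if Rlt_dec up xi then rp else 0).
  (* The value [up] on the vacuum is a placeholder: convergence of the velocity is claimed only
     where [rho0] is nonzero. *)
  set (u0 := fun xi => if Rlt_dec xi um then um else up).
  assert (vl : forall xi, xi < um -> rho0 xi = rm /\ u0 xi = um).
  { intros xi h; unfold rho0, u0; destruct (Rlt_dec xi um); [now split | lra]. }
  assert (vm : forall xi, um < xi < up -> rho0 xi = 0).
  { intros xi h; unfold rho0.
    destruct (Rlt_dec xi um); [lra |]; destruct (Rlt_dec up xi); [lra | easy]. }
  assert (vr : forall xi, up < xi -> rho0 xi = rp /\ u0 xi = up).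
  { intros xi h; unfold rho0, u0.
    destruct (Rlt_dec xi um); [lra |]; destruct (Rlt_dec up xi); [easy | lra]. }
  exists rho0, u0; split; [| repeat split].
  - intros xi hxm hxp.
    destruct (Rtotal_order xi um) as [h | [h | h]]; [| easy |].
    + destruct (vl xi h) as [-> ->]; split; [| intros _];
        apply filterlim_eventually_const; try exact _;
        generalize (hleft xi h); apply filter_imp; tauto.
    + destruct (Rtotal_order xi up) as [h' | [h' | h']]; [| easy |].
      (* In the vacuum the density eventually equals [rs k], which tends to 0, and the velocity
         claim is vacuous. *)
      * rewrite (vm xi (conj h h')); split; [| easy].
        apply (filterlim_ext_loc rs); [now apply hmid | exact hrs].
      * destruct (vr xi h') as [-> ->]; split; [| intros _];
          apply filterlim_eventually_const; try exact _;
          generalize (hright xi h'); apply filter_imp; tauto.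
  - now apply vl.
  - now apply vl.
  - exact vm.
  - now apply vr.
  - now apply vr.
  - apply filterlim_eventually_const; [exact _ |].
    generalize (at_left_above (um - 1) um ltac:(lra)).
    apply filter_imp; intros x hx; apply vl; lra.
  - apply filterlim_eventually_const; [exact _ |].
    generalize (at_right_below um up hu); apply filter_imp; exact vm.
  - lra.
  - apply filterlim_eventually_const; [exact _ |].
    generalize (at_left_above (um - 1) um ltac:(lra)).
    apply filter_imp; intros x hx; apply vl; lra.
  - apply filterlim_eventually_const; [exact _ |].
    generalize (at_left_above um up hu); apply filter_imp; exact vm.
  - apply filterlim_eventually_const; [exact _ |].
    generalize (at_right_below up (up + 1) ltac:(lra)).
    apply filter_imp; intros x hx; apply vr; lra.
  - lra.
  - apply filterlim_eventually_const; [exact _ |].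
    generalize (at_right_below up (up + 1) ltac:(lra)).
    apply filter_imp; intros x hx; apply vr; lra.
Qed.
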